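(* Let $q>2$, $\sigma,B,K>0$, and let $X_1,\dots,X_n$ be independent mean-zero real-valued random variables with \[ \frac1n\sum_{i=1}^n\mathrm{Var}[X_i]\le\sigma^2,\qquad\frac1n\sum_{i=1}^n\mathbb{E}[|X_i|^q]\le B^q,\qquad\max_{1\le i\le n}|X_i|\le K\ \text{a.s.} \] Then for every $z>1$, \[ \mathbb{P}\Big(\frac1n\sum_{i=1}^nX_i\ge B\Big(\frac{\sigma^2}{B^2}\Big)^{\frac{q-1}{q-2}}\Psi^{-1}\Big[\Big(\frac{B^2}{\sigma^2}\Big)^{\frac q{q-2}}\frac{\ln z}n\Big]+\frac{B^q}{K^{q-1}}\Psi^{-1}\Big[\Big(\frac KB\Big)^q\frac{\ln z}n\Big]\Big)\le\frac1z. \]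
   Context: $\Psi(x)=(1+x)\ln(1+x)-x$ for $x\ge0$, and $\Psi^{-1}$ is its inverse on $[0,\infty)$. *)

(* Defs.v *)
From HB Require Import structures.
From mathcomp Require Import all_boot all_order all_algebra.
From mathcomp Require Import all_classical all_reals all_analysis.
Set Implicit Arguments. Unset Strict Implicit. Unset Printing Implicit Defensive.
Import Order.TTheory GRing.Theory Num.Theory.
Local Open Scope classical_set_scope.
Local Open Scope ring_scope.

Definition Psi {R : realType} (x : R) : R := (1 + x) * ln (1 + x) - x.

(* Psi^{-1}: inverse of Psi on [0, oo): the (unique) t >= 0 with Psi t = y
   (chosen by classical choice; default 0 if none exists, which only happens
   for y < 0). *)
Definition Psi_inv {R : realType} (y : R) : R :=
  xget 0 [set t : R | 0 <= t /\ Psi t = y].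

Definition mutually_independent {d} {T : measurableType d} {R : realType}
  (P : probability T R) (n : nat) (X : 'I_n -> {RV P >-> R}) : Prop :=
  forall (J : {set 'I_n}) (B : 'I_n -> set R),
    (forall i, i \in J -> measurable (B i)) ->
    P (\bigcap_(i in [set i | i \in J]) (X i @^-1` B i)) =
    (\prod_(i in J) P (X i @^-1` B i))%E.

(* Main.v *)
(* Write phi(y) = e^y - 1 - y and a = (B^q / sigma^2)^(1/(q-2)).  Expanding phi
   in powers, the terms of degree k < q are bounded by interpolating |x|^k
   between x^2 and |x|^q at scale a, those of degree k >= q by K^(k-q) |x|^q.
   Hence, for lambda >= 0, the log-mgf of the sum at lambda is at most
   n (psi_1 + psi_2)(lambda) with
   psi_1(lambda) = (sigma^2 / a^2) phi(a lambda) and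
   psi_2(lambda) = (B^q / K^q) phi(K lambda), two Poisson cumulant functions.
   The Legendre transform of each psi_j is inverted by Psi^-1, with optimal
   parameter L_j.  Since psi_j(lambda)/lambda is nondecreasing, the choice
   1/lambda = 1/L_1 + 1/L_2 in Chernoff's bound costs only the sum of the two
   inverted Legendre transforms. *)
Require Import Defs.
From HB Require Import structures.
From mathcomp Require Import all_boot all_order all_algebra.
From mathcomp Require Import all_classical all_reals all_analysis.
From mathcomp Require Import ring lra measurable_realfun.
Import Order.TTheory GRing.Theory Num.Theory.
Import numFieldNormedType.Exports HBNNSimple.
Local Open Scope classical_set_scope.
Local Open Scope ring_scope.
Local Open Scope ereal_scope.
Local Open Scope ring_scope.

(** * Interpolation of powers and remainders of the exponential series *)

Lemma expR_le_chord (R : realType) (w x y : R) : 0 <= w <= 1 ->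
  expR ((1 - w) * x + w * y) <= (1 - w) * expR x + w * expR y.
Proof.
move=> /andP[w0 w1]; set c := (1 - w) * x + w * y.
(* This is the tangent line of the exponential at the barycentre [c]. In the weighted average of its
   values at [x] and [y] the linear terms cancel and [expR c] remains. *)
have H t : expR c * (1 + (t - c)) <= expR t.
  have -> : expR t = expR c * expR (t - c) by rewrite -expRD subrKC.
  by apply: ler_wpM2l; [exact: expR_ge0|exact: expR_ge1Dx].
have -> : expR c = (1 - w) * (expR c * (1 + (x - c)))
                 + w * (expR c * (1 + (y - c))).
  by rewrite /c; ring.
by apply: lerD; apply: ler_wpM2l => //; rewrite subr_ge0.
Qed.

Lemma powR_div (R : realType) (x y r : R) : 0 <= x -> 0 < y ->
  (x / y) `^ r = x `^ r / y `^ r.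
Proof.
move=> x0 y0; have y0' := ltW y0.
rewrite powRM ?invr_ge0//; congr (_ * _).
by rewrite -(powR_inv1 y0') -powRrM mulN1r powRN.
Qed.

(** The map r -> s^r = exp(r ln s) is convex, and [k] is the barycentre of 2 and [q] with weight
    [w]. At [s] = 0 there is no logarithm to use; there the left side vanishes because [k] is
    positive. *)
Lemma expr_le_interp (R : realType) (q w s : R) (k : nat) : 0 <= w <= 1 ->
  0 <= s -> k%:R = (1 - w) * 2 + w * q -> (2 <= k)%N ->
  s ^+ k <= (1 - w) * s ^+ 2 + w * s `^ q.
Proof.
move=> w01 s0 kE k2; move: (w01) => /andP[w0 w1].
have [->|sn0] := eqVneq s 0.
  rewrite !expr0n/= (gtn_eqF (ltnW k2))/= mulr0 add0r mulr_ge0//.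
have sp : 0 < s by rewrite lt_neqAle eq_sym sn0.
have E (r : R) : s `^ r = expR (r * ln s) by rewrite /powR (negbTE sn0).
rewrite -!powR_mulrn// !E.
have -> : k%:R * ln s = (1 - w) * (2%:R * ln s) + w * (q * ln s).
  by rewrite kE; ring.
exact: expR_le_chord.
Qed.

Definition expR_tail (R : realType) (m : nat) (y : R) : R :=
  expR y - series (exp_coeff y) m.

(** For every degree k >= m, y^k <= s^k Y^k <= s^m Y^k because 0 <= s <= 1. Summing over m <= k < n
    and letting n tend to infinity gives the bound, whatever the sign of [y]. *)
Lemma expR_tail_le (R : realType) (m : nat) (s y Y : R) :
  0 <= s <= 1 -> 0 <= Y -> `|y| = s * Y ->
  expR_tail R m y <= s ^+ m * expR_tail R m Y.
Proof.
move=> /andP[s0 s1] Y0 yE.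
have cy := @is_cvg_series_exp_coeff R.
pose f (x : R) n := series (exp_coeff x) n - series (exp_coeff x) m.
have cf x : f x n @[n --> \oo] --> expR_tail R m x.
  by apply: cvgB; [exact: cy|exact: cvg_cst].
rewrite -(cvg_lim _ (cf y))//.
have cfs : (s ^+ m * f Y n) @[n --> \oo] --> s ^+ m * expR_tail R m Y.
  by apply: cvgMr; exact: cf.
rewrite -(cvg_lim _ cfs)//; apply: ler_lim.
- by apply/cvg_ex; eexists; exact: cf.
- by apply/cvg_ex; eexists; exact: cfs.
exists m => // n/= mn.
rewrite /f !sub_series mn mulr_sumr !big_nat; apply: ler_sum => i /andP[mi _].
rewrite /exp_coeff/= mulrA ler_wpM2r ?invr_ge0//.
apply: le_trans (ler_norm _) _; rewrite normrX yE exprMn ler_wpM2r ?exprn_ge0//.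
by rewrite ler_wiXn2l.
Qed.

Lemma series_exp_coeff_le (R : realType) (m : nat) (y : R) : 0 <= y ->
  series (exp_coeff y) m <= expR y.
Proof.
move=> y0; apply: (nondecreasing_cvgn_le _ (is_cvg_series_exp_coeff y)).
by apply: nondecreasing_series => i _ _; exact: exp_coeff_ge0.
Qed.

Lemma series_exp_coeff2 (R : realType) (y : R) :
  series (exp_coeff y) 2 = 1 + y.
Proof.
rewrite /series/= !big_nat_recr//= big_geq// /exp_coeff/=.
by rewrite expr0 expr1 !divr1 add0r.
Qed.

(** The remainder of order 2 is e^y - 1 - y, and raising the order only removes nonnegative
    terms. *)
Lemma expR_tail_le_bennett (R : realType) (m : nat) (y : R) : 0 <= y -> (2 <= m)%N ->
  expR_tail R m y <= expR y - 1 - y.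
Proof.
move=> y0 m2; rewrite /expR_tail -addrA lerD2l -opprD lerN2.
rewrite -series_exp_coeff2.
by apply: nondecreasing_series => // i _ _; exact: exp_coeff_ge0.
Qed.

(** * Scalar estimates: inverting [Psi], and dominating the exponential by two powers *)

Lemma Psi_invK_gt0 (R : realType) (y : R) : 0 < y ->
  0 < Psi_inv y /\ Psi (Psi_inv y) = y.
Proof.
move=> y0; rewrite /Psi_inv.
case: xgetP => [t _ [t0 tE]|H].
  split=> //; rewrite lt_neqAle t0 andbT; apply/eqP => t00.
  by move: tE; rewrite -t00 /Psi addr0 ln1 mulr0 subr0 => y00; rewrite y00 ltxx in y0.
exfalso.
(* Since ln(1 + b) = y + 1, [Psi b] equals y e^(y+1) + 1, which exceeds [y]. The intermediate value
   theorem on [0, b] then contradicts the absence of a preimage. *)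
pose b := expR (y + 1) - 1 : R.
have b0 : 0 <= b by have := expR_ge1Dx (y + 1); rewrite /b; lra.
have P0 : Psi (0 : R) = 0 by rewrite /Psi addr0 ln1 mulr0 subr0.
have Pb : y <= Psi b.
  rewrite /Psi /b subrKC expRK.
  have := expR_ge1Dx (y + 1); nra.
have [] := @IVT R Psi 0 b y b0.
- apply: continuous_in_subspaceT => x; rewrite inE/= in_itv/= => /andP[x0 _].
  have x1 : 0 < 1 + x by lra.
  apply: cvgB; last exact: cvg_id.
  apply: cvgM; first by apply: cvgD; [exact: cvg_cst|exact: cvg_id].
  have cx : (1 + t) @[t --> x] --> 1 + x.
    by apply: cvgD; [exact: cvg_cst|exact: cvg_id].
  exact: cvg_comp cx (continuous_ln x1).
- by rewrite P0 ge_min (ltW y0)/= le_max Pb orbT.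
move=> t; rewrite in_itv/= => /andP[t0 _] tE.
by apply: (H t).
Qed.

(** Put L = ln(1 + u) / a, the maximiser in the Legendre transform of l -> c (e^(la) - 1 - la) at
    the point a c u, where the transform equals c Psi(u) = v. The right side is linear in [l] and
    meets the left side at 0 and at L. It is thus a chord of a convex function, and lies above it
    between these two points. *)
Lemma bennett_legendre (R : realType) (a c u v l : R) :
  0 < a -> 0 < c -> 0 < u -> Psi u = v / c -> 0 <= l <= ln (1 + u) / a ->
  c * (expR (l * a) - 1 - l * a) <= l * (a * (c * u) - v / (ln (1 + u) / a)).
Proof.
move=> a0 c0 u0 uE /andP[l0 lL].
have u1 : 0 < 1 + u by lra.
have L0 : 0 < ln (1 + u) by rewrite ln_gt0//; lra.
set L := ln (1 + u) in lL L0 *.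
pose w := l * a / L.
have w01 : 0 <= w <= 1.
  by rewrite divr_ge0 ?mulr_ge0 ?(ltW a0) ?(ltW L0)//= ler_pdivrMr// mul1r -ler_pdivlMr.
have := expR_le_chord _ w 0 L w01.
rewrite mulr0 add0r expR0 mulr1 {2}/L lnK//.
have wL : w * L = l * a by rewrite /w mulfVK ?gt_eqF.
rewrite wL => H.
have vE : v = c * ((1 + u) * L - u).
  by rewrite -/(Psi u) uE mulrC divfK ?gt_eqF.
have -> : l * (a * (c * u) - v / (L / a)) = c * (w * u - w * L).
  rewrite vE /w; field; by rewrite ?gt_eqF.
rewrite wL ler_pM2l//; lra.
Qed.

(** The pointwise bound is meant to be integrated against a centred variable, which leaves only
    moments of order 2 and [q]. The combination A + D a^(q-2) is the resulting A sigma^2 + D B^q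
    divided by sigma^2, once [a] is chosen with a^(q-2) = B^q / sigma^2. *)
Lemma exp_moment_domination (R : realType) (q a K l : R) :
  2 < q -> 0 < a -> 0 < K -> 0 <= l ->
  exists A D : R, [/\ 0 <= A, 0 <= D,
    (forall x, `|x| <= K ->
       expR (l * x) <= 1 + l * x + A * x ^+ 2 + D * `|x| `^ q) &
    A + D * a `^ (q - 2) <= (expR (l * a) - 1 - l * a) / a ^+ 2
      + a `^ (q - 2) / K `^ q * (expR (l * K) - 1 - l * K)].
Proof.
move=> q2 a0 K0 l0.
have q20 : 0 < q - 2 by lra.
(* degrees below [m] are at most [q], all others exceed it *)
pose m := (Num.truncn q).+1.
have mq : q < m%:R by exact: truncnS_gt.
have kq k : (k < m)%N -> k%:R <= q.
  rewrite ltnS => km; apply: (@le_trans _ _ (Num.truncn q)%:R).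
    by rewrite ler_nat.
  by have /andP[] : (Num.truncn q)%:R <= q < (Num.truncn q).+1%:R
    by apply: truncn_itv; lra.
have m2 : (2 <= m)%N.
  by rewrite -(ler_nat R) ltW// (lt_trans q2).
(* The weight for which k = (1 - w k) 2 + (w k) q. *)
pose w (k : nat) : R := (k%:R - 2) / (q - 2).
have w01 k : (2 <= k < m)%N -> 0 <= w k <= 1.
  move=> /andP[k2 km]; rewrite /w ler_pdivlMr// ler_pdivrMr// mul0r mul1r.
  have := kq k km; have : 2 <= k%:R :> R by rewrite ler_nat.
  by move=> ? ?; apply/andP; split; lra.
pose e (k : nat) := exp_coeff (l * a) k.
have e0 k : 0 <= e k by apply: exp_coeff_ge0; rewrite mulr_ge0// ltW.
have tK0 : 0 <= expR_tail R m (l * K).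
  by rewrite subr_ge0; apply: series_exp_coeff_le; rewrite mulr_ge0// ltW.
have Kq0 : 0 < K `^ q by exact: powR_gt0.
have aq0 : 0 < a `^ (q - 2) by exact: powR_gt0.
have aqE : a `^ q = a ^+ 2 * a `^ (q - 2).
  rewrite -powR_mulrn ?ltW// -powRD; last by rewrite (gt_eqF a0) implybT.
  by congr (_ `^ _); lra.
(* Interpolating s^k at s = |x| / a splits the term of degree k < m into a part in x^2 / a^2,
   collected in [A], and a part in |x|^q / a^q, collected in [D]. The whole remainder of order [m]
   goes to [D], at scale [K]. *)
pose A : R := (\sum_(2 <= k < m) (1 - w k) * e k) / a ^+ 2.
pose D : R := (\sum_(2 <= k < m) w k * e k) / a `^ q + expR_tail R m (l * K) / K `^ q.
exists A; exists D; rewrite /A /D {A D}.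
split.
- rewrite divr_ge0 ?exprn_ge0 ?(ltW a0)// big_nat sumr_ge0// => k km.
  by have /andP[? ?] := w01 k km; rewrite mulr_ge0// subr_ge0.
- rewrite addr_ge0// divr_ge0 ?powR_ge0// big_nat sumr_ge0// => k km.
  by have /andP[? ?] := w01 k km; rewrite mulr_ge0.
- move=> x xK.
  have s1 : 0 <= `|x| / K <= 1.
    by rewrite divr_ge0 ?(ltW K0)//= ler_pdivrMr// mul1r.
  (* With s = |x| / K <= 1 the remainder scales by s^m, and s^m <= s^q because q < m. *)
  have tl : expR_tail R m (l * x) <= `|x| `^ q / K `^ q * expR_tail R m (l * K).
    apply: (le_trans (expR_tail_le _ _ (`|x| / K) _ (l * K) s1 _ _)).
    - by rewrite mulr_ge0// ltW.
    - by rewrite normrM (ger0_norm l0) mulrCA divfK ?gt_eqF.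
    rewrite ler_wpM2r// -powR_mulrn; last by case/andP: s1.
    have [->|x0] := eqVneq x 0.
      rewrite normr0 mul0r !powR0 ?mul0r ?gt_eqF//; lra.
    have xp : 0 < `|x| by rewrite normr_gt0.
    rewrite -powR_div ?normr_ge0//.
    by apply: ger_powR; [rewrite divr_gt0//=; case/andP: s1|exact: ltW].
  have hd : \sum_(2 <= k < m) exp_coeff (l * x) k <=
     (\sum_(2 <= k < m) (1 - w k) * e k) / a ^+ 2 * x ^+ 2 +
     (\sum_(2 <= k < m) w k * e k) / a `^ q * `|x| `^ q.
    rewrite !mulr_suml -big_split/= !big_nat; apply: ler_sum => k km.
    have kE : k%:R = (1 - w k) * 2 + w k * q.
      by rewrite /w; field; rewrite gt_eqF.
    have s0 : 0 <= `|x| / a by rewrite divr_ge0// ltW.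
    have := expr_le_interp _ q (w k) (`|x| / a) k (w01 k km) s0 kE.
    case/andP: (km) => -> _ /(_ isT) H.
    apply: (@le_trans _ _ (e k * (`|x| / a) ^+ k)).
      rewrite /e /exp_coeff/= mulrAC -exprMn.
      have -> : l * a * (`|x| / a) = l * `|x| by field; rewrite gt_eqF.
      rewrite ler_wpM2r ?invr_ge0// (le_trans (ler_norm _))//.
      by rewrite normrX normrM (ger0_norm l0).
    apply: (le_trans (ler_wpM2l (e0 k) H)).
    rewrite powR_div ?normr_ge0// exprMn exprVn real_normK ?num_real//.
    by rewrite le_eqVlt; apply/orP; left; apply/eqP; ring.
  have -> : expR (l * x) = 1 + l * x + \sum_(2 <= k < m) exp_coeff (l * x) k +
      expR_tail R m (l * x).
    rewrite -(sub_series_geq _ m2) /expR_tail.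
    rewrite series_exp_coeff2.
    by ring.
  rewrite [leRHS](_ : _ = 1 + l * x + ((\sum_(2 <= k < m) (1 - w k) * e k) / a ^+ 2 * x ^+ 2 +
     (\sum_(2 <= k < m) w k * e k) / a `^ q * `|x| `^ q) + `|x| `^ q / K `^ q * expR_tail R m (l * K)); last by ring.
  by rewrite lerD// lerD2l.
(* As a^q = a^2 a^(q-2), both groups of interpolated terms carry the factor 1 / a^2, and their
   weights add up to 1. What is left is the series between degrees 2 and [m], at most e^(la) - 1 -
   la. *)
- rewrite mulrDl addrA.
  have -> : (\sum_(2 <= k < m) (1 - w k) * e k) / a ^+ 2 +
      (\sum_(2 <= k < m) w k * e k) / a `^ q * a `^ (q - 2) =
      (\sum_(2 <= k < m) e k) / a ^+ 2.
    rewrite aqE [X in _ + X](_ : _ = (\sum_(2 <= k < m) w k * e k) / a ^+ 2).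
      rewrite -mulrDl -big_split/=; congr (_ / _).
      by apply: eq_bigr => k _; ring.
    by field; rewrite !gt_eqF.
  apply: lerD.
    rewrite ler_wpM2r ?invr_ge0 ?exprn_ge0 ?(ltW a0)//.
    rewrite -(sub_series_geq _ m2).
    rewrite series_exp_coeff2.
    have := series_exp_coeff_le _ m (l * a) (mulr_ge0 l0 (ltW a0)).
    lra.
  rewrite [leLHS](_ : _ =
    a `^ (q - 2) / K `^ q * expR_tail R m (l * K)); last by ring.
  rewrite ler_wpM2l ?divr_ge0 ?powR_ge0//.
  by apply: expR_tail_le_bennett => //; rewrite mulr_ge0// ltW.
Qed.

(** * Integration, independence and the moment generating function of one variable *)

Lemma ae_bounded_integrable (d : measure_display) (T : measurableType d)
    (R : realType) (P : {finite_measure set T -> \bar R}) (f : T -> R) (M : R) :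
  measurable_fun setT f -> {ae P, forall x, `|f x| <= M} ->
  P.-integrable setT (EFin \o f).
Proof.
move=> mf fM; apply/integrableP; split; first exact/measurable_EFinP.
apply: (@le_lt_trans _ _ (\int[P]_x (`|M|)%:E)%E).
  apply: ae_ge0_le_integral => //.
  - exact/measurable_EFinP/measurableT_comp.
  - apply: filterS fM => x fxM _ /=.
    by rewrite lee_fin (le_trans fxM)// ler_norm.
rewrite integral_cst// lte_mul_pinfty//.
by rewrite -ge0_fin_numE// fin_num_measure.
Qed.

(** Decompose [h] over its level sets and apply the hypothesis to each; levels at negative values
    are empty. The right side is left as a finite sum so that the case G = 1, c = 1 produces the
    same sum. *)
Lemma integral_mul_nnsfun (d : measure_display) (T : measurableType d)
    (R : realType) (P : {measure set T -> \bar R}) (G Y : T -> R) (c : R)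
    (h : {nnsfun R >-> R}) :
  measurable_fun setT G -> (forall x, 0 <= G x) -> measurable_fun setT Y ->
  0 <= c ->
  (forall A : set R, measurable A ->
    (\int[P]_x (G x * \1_A (Y x))%:E = c%:E * P (Y @^-1` A))%E) ->
  (\int[P]_x (G x * h (Y x))%:E =
    c%:E * \sum_(r \in range h) (r%:E * P (Y @^-1` (h @^-1` [set r]))))%E.
Proof.
move=> mG G0 mY c0 H.
have mA r : measurable (h @^-1` [set r]) by [].
have mI r : measurable_fun setT (fun x => \1_(h @^-1` [set r]) (Y x) : R).
  exact: (measurableT_comp (measurable_indic (mA r)) mY).
transitivity (\int[P]_x (\sum_(r \in range h)
    (G x * (r * \1_(h @^-1` [set r]) (Y x)))%:E))%E.
  apply: eq_integral => x _; rewrite fsumEFin//; congr EFin.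
  by rewrite {1}(fimfunE h) mulr_fsumr.
rewrite ge0_integral_fsum//; last 2 first.
- move=> r; apply/measurable_EFinP/measurable_funM => //.
  exact: measurable_funM.
- move=> r x _; rewrite lee_fin mulr_ge0//.
  by rewrite -lee_fin nnfun_muleindic_ge0.
rewrite ge0_mule_fsumr; last first.
  move=> r; have [r0|r0] := leP 0 r; first by rewrite mule_ge0.
  by rewrite preimage_nnfun0// preimage_set0 measure0 mule0.
apply: eq_fsbigr => r _.
have [r0|r0] := leP 0 r; last first.
  rewrite preimage_nnfun0// preimage_set0 measure0 !mule0.
  by under eq_integral do rewrite indic0 !mulr0; rewrite integral0.
under eq_integral do rewrite mulrCA EFinM.
rewrite ge0_integralZl_EFin//.
- by rewrite H// muleCA.
- by move=> x _; rewrite lee_fin mulr_ge0.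
- exact/measurable_EFinP/measurable_funM.
Qed.

(** Simple functions increase to [f]. At each stage the integral with [G] is [c] times the one with
    G = 1, both being computed by the previous lemma; monotone convergence on the two sides and
    uniqueness of limits conclude. *)
Lemma integral_mul_fun_of_indic (d : measure_display) (T : measurableType d)
    (R : realType) (P : {measure set T -> \bar R}) (G Y : T -> R) (c : R)
    (f : R -> R) :
  measurable_fun setT G -> (forall x, 0 <= G x) -> measurable_fun setT Y ->
  0 <= c ->
  (forall A : set R, measurable A ->
    (\int[P]_x (G x * \1_A (Y x))%:E = c%:E * P (Y @^-1` A))%E) ->
  measurable_fun setT f -> (forall r, 0 <= f r) ->
  (\int[P]_x (G x * f (Y x))%:E = c%:E * \int[P]_x (f (Y x))%:E)%E.
Proof.
move=> mG G0 mY c0 H mf f0.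
have mfE : measurable_fun setT (EFin \o f) by exact/measurable_EFinP.
pose h := nnsfun_approx measurableT mfE.
have f0E y : (setT : set R) y -> (0 <= (EFin \o f) y)%E by rewrite lee_fin.
have hf y : (h k y)%:E @[k --> \oo] --> (f y)%:E.
  exact: (cvg_nnsfun_approx measurableT mfE f0E (x := y)).
have ndh k m y : (k <= m)%N -> h k y <= h m y.
  by move=> km; exact/lefP/nd_nnsfun_approx.
have mc (F : T -> R) : measurable_fun setT F -> (forall x, 0 <= F x) ->
    (\int[P]_x (F x * h k (Y x))%:E @[k --> \oo] -->
     \int[P]_x (F x * f (Y x))%:E)%E.
  move=> mF F0.
  rewrite [X in _ --> X](_ : _ = (\int[P]_x
      (limn (fun k => (F x * h k (Y x))%:E)))%E); last first.
    apply: eq_integral => x _; apply/esym/cvg_lim => //.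
    exact: (cvgeZl (y := (F x)%:E) isT (hf (Y x))).
  apply: cvg_monotone_convergence => //.
  - move=> k; apply/measurable_EFinP/measurable_funM => //.
    exact: measurableT_comp.
  - by move=> k x _; rewrite lee_fin mulr_ge0.
  - by move=> x _ k m km; rewrite lee_fin ler_wpM2l// ndh.
have e1 k := integral_mul_nnsfun _ _ _ P G Y c (h k) mG G0 mY c0 H.
have e2 k : (\int[P]_x (1 * h k (Y x))%:E =
    \sum_(r \in range (h k)) (r%:E * P (Y @^-1` (h k @^-1` [set r]))))%E.
  rewrite (integral_mul_nnsfun _ _ _ P (cst 1) Y 1)//; first by rewrite mul1e.
  move=> A mA; rewrite mul1e.
  have mYA : measurable (Y @^-1` A) by rewrite -[X in measurable X]setTI; exact: mY.
  under eq_integral do rewrite mul1r.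
  by rewrite (integral_indic P measurableT mYA) setIT.
have c1 := mc G mG G0.
have c2 := mc (cst 1) (measurable_cst _) (fun=> ler01).
have {c2} c2 : ((c%:E * \int[P]_x (1 * h k (Y x))%:E) @[k --> \oo] -->
   c%:E * \int[P]_x (1 * f (Y x))%:E)%E by exact: cvgeZl.
under [in RHS]eq_integral do rewrite -[f _]mul1r.
apply: (cvg_unique _ c1); rewrite //=.
rewrite [X in X @ _ --> _](_ : _ = (fun k => c%:E * \int[P]_x (1 * h k (Y x))%:E)%E)//.
by apply/funext => k; rewrite e1 e2.
Qed.

Lemma independent_integral_prod (d : measure_display) (T : measurableType d)
    (R : realType) (P : probability T R) (n : nat) (X : 'I_n -> {RV P >-> R})
    (f : 'I_n -> R -> R) :
  mutually_independent X ->
  (forall i, measurable_fun setT (f i)) -> (forall i r, 0 <= f i r) ->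
  (forall i, (\int[P]_x (f i (X i x))%:E)%E \is a fin_num) ->
  (\int[P]_x (\prod_(i < n) f i (X i x))%:E =
    (\prod_(i < n) fine (\int[P]_x (f i (X i x))%:E))%:E)%E.
Proof.
move=> Xi.
(* The functions are released from being indicators one index at a time. *)
suff main (k : nat) (g : 'I_n -> R -> R) (A : 'I_n -> set R) :
    (forall i : 'I_n, (k <= i)%N -> measurable (A i) /\ g i = \1_(A i)) ->
    (forall i, measurable_fun setT (g i)) -> (forall i r, 0 <= g i r) ->
    (forall i, (\int[P]_x (g i (X i x))%:E)%E \is a fin_num) ->
    (\int[P]_x (\prod_(i < n) g i (X i x))%:E =
      (\prod_(i < n) fine (\int[P]_x (g i (X i x))%:E))%:E)%E.
  move=> mf f0 ffin; apply: (main n f (fun=> set0)) => // i.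
  by rewrite leqNgt ltn_ord.
have mX i (B : set R) : measurable B -> measurable (X i @^-1` B).
  by move=> mB; rewrite -[Y in measurable Y]setTI; exact: measurable_funP.
have indE i (B : set R) : measurable B ->
    (\int[P]_x (\1_B (X i x))%:E = P (X i @^-1` B))%E.
  by move=> mB; rewrite (integral_indic P measurableT (mX i B mB)) setIT.
elim: k g A => [|k IH] g A gA mg g0 gfin.
  have prodE (F : 'I_n -> R) : (\prod_i (F i)%:E = (\prod_i F i)%:E)%E.
    by rewrite (big_morph EFin (@EFinM R) (erefl _)).
  (* When every factor is an indicator, the product is the indicator of the intersection, and
     independence applies with the full index set. *)
  transitivity (P (\bigcap_(i in [set i | i \in [set: 'I_n]%SET]) (X i @^-1` A i))).
    rewrite -[X in _ = P X]setIT -integral_indic//; last first.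
      apply: fin_bigcap_measurable; first exact: finite_finset.
      by move=> i _; apply: mX; have [] := gA i isT.
    apply: eq_integral => x _; congr EFin.
    under eq_bigr => i _ do rewrite (gA i isT).2.
    rewrite indicE; case: (boolP (_ \in _)) => /=.
      rewrite inE/= => Hx; rewrite big1// => i _.
      by rewrite indicE mem_set//; apply: Hx; rewrite /= inE.
    rewrite notin_setE/= -existsNP => -[i Hi]; rewrite (bigD1 i)//= indicE.
    rewrite memNset ?mul0r// => Ai; exact: Hi.
  rewrite Xi; last by move=> i _; have [] := gA i isT.
  rewrite -prodE big_mkcond/=; apply: eq_bigr => i _; rewrite inE.
  by rewrite fineK// (gA i isT).2 indE//; have [] := gA i isT.
have [kn|nk] := ltnP k n; last first.
  apply: (IH g A) => // i ki.
  by have := leq_ltn_trans ki (ltn_ord i); rewrite ltnNge nk.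
pose i0 := Ordinal kn.
rewrite [in RHS](bigD1 i0)//= [in RHS]EFinM fineK// muleC.
under eq_integral => x _ do rewrite (bigD1 i0)//= mulrC.
apply: integral_mul_fun_of_indic => //.
- under eq_fun do rewrite -big_filter.
  apply: measurable_prod => i _.
  exact: measurableT_comp.
- by move=> x; apply: prodr_ge0.
- by apply: prodr_ge0 => i _; rewrite fine_ge0// integral_ge0// => x _; rewrite lee_fin.
(* The product of the other factors plays the role of [G], and [X i0] that of [Y]. Testing on [B]
   amounts to replacing the factor at [i0] by an indicator, which is an instance of the induction
   hypothesis. *)
move=> B mB.
pose g' i := if i == i0 then \1_B else g i.
pose A' i := if i == i0 then B else A i.
have g'i0 : g' i0 = \1_B by rewrite /g' eqxx.
have g'E i : i != i0 -> g' i = g i by rewrite /g' => /negbTE ->.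
have := IH g' A'.
rewrite (bigD1 i0)//= g'i0 indE//.
under eq_integral => x _ do rewrite (bigD1 i0)//= mulrC g'i0.
under [X in EFin (_ * X)]eq_bigr => i ii0 do rewrite g'E//.
rewrite mulrC EFinM fineK ?fin_num_measure//; last exact: mX.
move=> <-.
- by apply: eq_integral => x _; congr (EFin (_ * _)); apply: eq_bigr => i ii0; rewrite g'E.
- move=> i ki; rewrite /g' /A'; case: eqP => [_//|/eqP ii0].
  apply: gA; rewrite ltn_neqAle ki andbT; apply: contra ii0 => /eqP ik.
  by apply/eqP/val_inj.
- by move=> i; rewrite /g'; case: eqP => // _; exact: measurable_indic.
- by move=> i r; rewrite /g'; case: eqP.
- move=> i; have [->|ii0] := eqVneq i i0; last by rewrite g'E.
  by rewrite g'i0 indE// fin_num_measure//; exact: mX.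
Qed.

(** Integrate the domination: the linear term vanishes by centring, and 1 + t <= e^t puts the bound
    in a form that multiplies well. The finiteness claims, due to almost sure boundedness, give
    meaning to the uses of [fine]. *)
Lemma bounded_mgf_le (d : measure_display) (T : measurableType d)
    (R : realType) (P : probability T R) (Y : T -> R) (q K l A D : R) :
  measurable_fun setT Y -> {ae P, forall x, `|Y x| <= K} -> 0 <= q -> 0 <= K ->
  (\int[P]_x (Y x)%:E = 0)%E ->
  (forall y, `|y| <= K ->
    expR (l * y) <= 1 + l * y + A * y ^+ 2 + D * `|y| `^ q) ->
  [/\ (\int[P]_x (Y x ^+ 2)%:E)%E \is a fin_num,
      (\int[P]_x (`|Y x| `^ q)%:E)%E \is a fin_num,
      (\int[P]_x (expR (l * Y x))%:E)%E \is a fin_num &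
      fine (\int[P]_x (expR (l * Y x))%:E)%E <=
        expR (A * fine (\int[P]_x (Y x ^+ 2)%:E)%E +
              D * fine (\int[P]_x (`|Y x| `^ q)%:E)%E)].
Proof.
move=> mY YK q0 K0 EY dom.
have m2 : measurable_fun setT (fun x => Y x ^+ 2) by exact: measurable_funX.
have mq : measurable_fun setT (fun x => `|Y x| `^ q).
  apply: (measurableT_comp (f := fun y : R => y `^ q)).
    exact: measurable_powR.
  exact: measurableT_comp.
have me : measurable_fun setT (fun x => expR (l * Y x)).
  apply: (measurableT_comp (f := @expR R)); first exact: measurable_expR.
  by apply: measurable_funM.
have i1 : P.-integrable setT (fun x => (Y x)%:E).
  exact: (ae_bounded_integrable _ _ _ _ _ K mY YK).
have i2 : P.-integrable setT (fun x => (Y x ^+ 2)%:E).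
  apply: (ae_bounded_integrable _ _ _ _ _ (K ^+ 2) m2).
  by apply: filterS YK => x xK; rewrite normrX ler_sqr// ?nnegrE.
have iq : P.-integrable setT (fun x => (`|Y x| `^ q)%:E).
  apply: (ae_bounded_integrable _ _ _ _ _ (K `^ q) mq).
  apply: filterS YK => x xK; rewrite ger0_norm ?powR_ge0//.
  by apply: ge0_ler_powR; rewrite // nnegrE.
have ie : P.-integrable setT (fun x => (expR (l * Y x))%:E).
  apply: (ae_bounded_integrable _ _ _ _ _ (expR (`|l| * K)) me).
  apply: filterS YK => x xK; rewrite ger0_norm ?expR_ge0// ler_expR.
  by rewrite (le_trans (ler_norm _))// normrM ler_wpM2l.
have f2 := integrable_fin_num measurableT i2.
have fq := integrable_fin_num measurableT iq.
have fe := integrable_fin_num measurableT ie.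
split => //.
set v := (\int[P]_x (Y x ^+ 2)%:E)%E in f2 *.
set m := (\int[P]_x (`|Y x| `^ q)%:E)%E in fq *.
(* [h] is nonnegative only almost everywhere, hence the detour through [`|h|]. *)
pose h x := 1 + l * Y x + A * Y x ^+ 2 + D * `|Y x| `^ q.
have il : P.-integrable setT (fun x => (l * Y x)%:E).
  by under eq_fun do rewrite EFinM; exact: integrableZl.
have iA : P.-integrable setT (fun x => (A * Y x ^+ 2)%:E).
  by under eq_fun do rewrite EFinM; exact: integrableZl.
have iD : P.-integrable setT (fun x => (D * `|Y x| `^ q)%:E).
  by under eq_fun do rewrite EFinM; exact: integrableZl.
have ic : P.-integrable setT (fun x : T => (1 : R)%:E).
  exact: (finite_measure_integrable_cst P (1 : R)).
have icl : P.-integrable setT (fun x => (1 + l * Y x)%:E).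
  by under eq_fun do rewrite EFinD; exact: integrableD.
have icA : P.-integrable setT (fun x => (1 + l * Y x + A * Y x ^+ 2)%:E).
  by under eq_fun do rewrite EFinD; exact: integrableD.
have ih : P.-integrable setT (fun x => (h x)%:E).
  by under eq_fun do rewrite EFinD; exact: integrableD.
have Eh : (\int[P]_x (h x)%:E = (1 + A * fine v + D * fine m)%:E)%E.
  rewrite /h; under eq_integral do rewrite EFinD.
  rewrite integralD//; under eq_integral do rewrite EFinD.
  rewrite integralD//; under eq_integral do rewrite EFinD.
  rewrite integralD//.
  under [X in (_ + X + _ + _)%E]eq_integral do rewrite EFinM.
  under [X in (_ + _ + X + _)%E]eq_integral do rewrite EFinM.
  under [X in (_ + _ + _ + X)%E]eq_integral do rewrite EFinM.
  rewrite !integralZl// EY mule0 adde0 -/v -/m.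
  have -> : (\int[P]_x (1 : R)%:E = 1)%E.
    by rewrite integral_cst//= mul1e; exact: probability_setT.
  by rewrite !EFinD !EFinM !fineK.
have mh : measurable_fun setT h by apply/measurable_EFinP; exact: measurable_int ih.
rewrite -lee_fin fineK//.
apply: (@le_trans _ _ (\int[P]_x `|h x|%:E)%E).
  apply: ae_ge0_le_integral => //.
  - exact/measurable_EFinP.
  - exact/measurable_EFinP/measurableT_comp.
  - apply: filterS YK => x xK _; rewrite lee_fin.
    exact: le_trans (dom _ xK) (ler_norm _).
rewrite (ae_eq_integral (fun x => (h x)%:E))//; last 3 first.
- exact/measurable_EFinP/measurableT_comp.
- exact/measurable_EFinP.
- apply: filterS YK => x xK _; congr EFin; rewrite ger0_norm//.
  exact: le_trans (expR_ge0 _) (dom _ xK).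
by rewrite Eh lee_fin -addrA expR_ge1Dx.
Qed.

(** Writing B and s as exponentials turns each identity into one between exponents, linear in ln B
    and ln s. With c1 = s^2 / a^2, the last two constants are 1 / c1 and a c1, which is how the
    first term of the threshold acquires the same shape as the second. *)
Lemma scale_identities (R : realType) (q s B : R) : 2 < q -> 0 < s -> 0 < B ->
  let a := (B `^ q / s ^+ 2) `^ (q - 2)^-1 in
  [/\ 0 < a, a `^ (q - 2) = B `^ q / s ^+ 2,
      (B ^+ 2 / s ^+ 2) `^ (q / (q - 2)) = a ^+ 2 / s ^+ 2 &
      B * (s ^+ 2 / B ^+ 2) `^ ((q - 1) / (q - 2)) = s ^+ 2 / a].
Proof.
move=> q2 s0 B0 a.
have q20 : q - 2 != 0 by rewrite gt_eqF// subr_gt0.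
have E2 (x : R) : expR x ^+ 2 = expR (2 * x).
  by rewrite -expRM_natl.
have EX (x y : R) : expR x `^ y = expR (y * x).
  by rewrite /powR gt_eqF ?expR_gt0// expRK.
pose b := ln B; pose t := ln s.
have BE : B = expR b by rewrite lnK.
have sE : s = expR t by rewrite lnK.
have aE : a = expR ((q - 2)^-1 * (q * b - 2 * t)).
  by rewrite /a BE sE E2 EX -expRN -expRD EX.
rewrite aE BE sE !E2 -!expRN -?expRD !EX -?expRD; split.
- exact: expR_gt0.
- by congr expR; field.
- by congr expR; field.
- by congr expR; field.
Qed.

(** * Chernoff's bound for the sum *)

Theorem theorem4p1 (R : realType) (d : measure_display) (T : measurableType d)
  (P : probability T R) (n : nat) (X : 'I_n -> {RV P >-> R})
  (q sigma B K : R) :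
  (0 < n)%N -> 2 < q -> 0 < sigma -> 0 < B -> 0 < K ->
  mutually_independent X ->
  (forall i, ('E_P[X i] = 0)%E) ->
  ((n%:R^-1)%:E * (\sum_(i < n) 'V_P[X i]) <= (sigma ^+ 2)%:E)%E ->
  ((n%:R^-1)%:E * (\sum_(i < n) 'E_P[fun x => (`|X i x| `^ q)%R]) <= (B `^ q)%:E)%E ->
  {ae P, forall x, forall i : 'I_n, `|X i x| <= K} ->
  forall z : R, 1 < z ->
  (P [set x | (n%:R^-1 * (\sum_(i < n) X i x) >=
       B * (sigma ^+ 2 / B ^+ 2) `^ ((q - 1) / (q - 2)) *
         Psi_inv ((B ^+ 2 / sigma ^+ 2) `^ (q / (q - 2)) * (ln z / n%:R))
       + B `^ q / K `^ (q - 1) *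
         Psi_inv ((K / B) `^ q * (ln z / n%:R)))%R]
   <= (z^-1)%:E)%E.
Proof.
move=> n0 q2 s0 B0 K0 Xind EX0 hV hQ XK z z1.
have nR : 0 < n%:R :> R by rewrite ltr0n.
set v := ln z / n%:R.
have v0 : 0 < v by rewrite divr_gt0// ln_gt0.
have [a0 aq E1 E3] := scale_identities R q sigma B q2 s0 B0.
set a := (_ `^ (q - 2)^-1) in a0 aq E1 E3.
have s20 : 0 < sigma ^+ 2 by rewrite exprn_gt0.
have Bq0 : 0 < B `^ q by exact: powR_gt0.
have Kq0 : 0 < K `^ q by exact: powR_gt0.
(* [c1] and [c2] are the intensities of the two Poisson cumulant functions, with jump sizes [a] and
   [K]. The threshold becomes a c1 u1 + K c2 u2 with Psi(u_j) = v / c_j. *)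
pose c1 := sigma ^+ 2 / a ^+ 2.
pose c2 := B `^ q / K `^ q.
have c10 : 0 < c1 by rewrite divr_gt0// exprn_gt0.
have c20 : 0 < c2 by rewrite divr_gt0.
have {}E1 : (B ^+ 2 / sigma ^+ 2) `^ (q / (q - 2)) * v = v / c1.
  by rewrite E1 /c1 invf_div mulrC.
have {}E3 : B * (sigma ^+ 2 / B ^+ 2) `^ ((q - 1) / (q - 2)) = a * c1.
  by rewrite E3 /c1; field; rewrite gt_eqF.
have E2 : (K / B) `^ q * v = v / c2.
  by rewrite powR_div ?(ltW K0)// /c2 invf_div mulrC.
have E4 : B `^ q / K `^ (q - 1) = K * c2.
  rewrite /c2 -(mulr_powRB1 (ltW K0) (_ : 0 < q)); last by lra.
  by field; rewrite !gt_eqF ?powR_gt0.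
rewrite E1 E2 E3 E4.
have [u10 Pu1] := Psi_invK_gt0 R (v / c1) (divr_gt0 v0 c10).
have [u20 Pu2] := Psi_invK_gt0 R (v / c2) (divr_gt0 v0 c20).
set u1 := Psi_inv (v / c1) in u10 Pu1 *.
set u2 := Psi_inv (v / c2) in u20 Pu2 *.
pose L1 := ln (1 + u1) / a; pose L2 := ln (1 + u2) / K.
have L10 : 0 < L1 by rewrite divr_gt0// ln_gt0//; lra.
have L20 : 0 < L2 by rewrite divr_gt0// ln_gt0//; lra.
(* This [l] lies below both [L1] and [L2], as the two chord bounds require, and their deficits
   satisfy l v / L1 + l v / L2 = v exactly. *)
pose l := (L1^-1 + L2^-1)^-1.
have l0 : 0 < l by rewrite invr_gt0 addr_gt0 ?invr_gt0.
have lL1 : 0 <= l <= L1.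
  by rewrite ltW//= -[leRHS]invrK lef_pV2 ?posrE ?addr_gt0 ?invr_gt0// lerDl invr_ge0 ltW.
have lL2 : 0 <= l <= L2.
  by rewrite ltW//= -[leRHS]invrK lef_pV2 ?posrE ?addr_gt0 ?invr_gt0// lerDr invr_ge0 ltW.
have b1 := bennett_legendre R a c1 u1 v l a0 c10 u10 Pu1 lL1.
have b2 := bennett_legendre R K c2 u2 v l K0 c20 u20 Pu2 lL2.
have [A [D [A0 D0 dom AD]]] := exp_moment_domination R q a K l q2 a0 K0 (ltW l0).
set tau := a * c1 * u1 + K * c2 * u2.
(* Multiplied by [n], this says that the bound on the log-mgf minus l n tau is at most -ln z. *)
have key : A * sigma ^+ 2 + D * B `^ q + v <= l * tau.
  have -> : A * sigma ^+ 2 + D * B `^ q = sigma ^+ 2 * (A + D * a `^ (q - 2)).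
    by rewrite aq; field; rewrite gt_eqF.
  have {}AD : sigma ^+ 2 * (A + D * a `^ (q - 2)) <=
      c1 * (expR (l * a) - 1 - l * a) + c2 * (expR (l * K) - 1 - l * K).
    apply: (le_trans (ler_wpM2l (ltW s20) AD)).
    rewrite le_eqVlt; apply/orP; left; apply/eqP; rewrite aq /c1 /c2.
    by field; rewrite !gt_eqF.
  have lv : l * (v / L1) + l * (v / L2) = v.
    by rewrite -mulrDr -mulrDr mulrCA mulVf ?mulr1// gt_eqF// addr_gt0 ?invr_gt0.
  move: b1 b2; rewrite -/L1 -/L2 => b1 b2.
  have -> : l * tau = l * (a * (c1 * u1) - v / L1) + l * (K * (c2 * u2) - v / L2) + v.
    by rewrite -[X in _ = _ + X]lv /tau; ring.
  by rewrite lerD2r (le_trans AD)// lerD.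
have XiK i : {ae P, forall x, `|X i x| <= K} by apply: filterS XK => x; apply.
have EX i : (\int[P]_x (X i x)%:E = 0)%E by rewrite -expectation_def.
have VE i : 'V_P[X i] = (\int[P]_x (X i x ^+ 2)%:E)%E.
  rewrite /variance covariance.unlock EX0 expectation.unlock.
  by apply: eq_integral => x _ /=; rewrite !fctE/= subr0.
have QE i : 'E_P[fun x => `|X i x| `^ q] = (\int[P]_x (`|X i x| `^ q)%:E)%E.
  by rewrite expectation.unlock.
have q0 : 0 <= q by lra.
have H i := bounded_mgf_le d T R P (X i) q K l A D (@measurable_funPT _ _ _ _ (X i)) (XiK i) q0
  (ltW K0) (EX i) dom.
have V_fin i : (\int[P]_x (X i x ^+ 2)%:E)%E \is a fin_num by have [] := H i.
have Q_fin i : (\int[P]_x (`|X i x| `^ q)%:E)%E \is a fin_num by have [] := H i.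
have M_fin i : (\int[P]_x (expR (l * X i x))%:E)%E \is a fin_num by have [] := H i.
have M_le i := (let: And4 _ _ _ h := H i in h).
pose V i := fine (\int[P]_x (X i x ^+ 2)%:E)%E.
pose Q i := fine (\int[P]_x (`|X i x| `^ q)%:E)%E.
have {}hV : \sum_(i < n) V i <= n%:R * sigma ^+ 2.
  move: hV; under eq_bigr do rewrite VE -(fineK (V_fin _)).
  by rewrite sumEFin -EFinM lee_fin ler_pdivrMl.
have {}hQ : \sum_(i < n) Q i <= n%:R * B `^ q.
  move: hQ; under eq_bigr do rewrite QE -(fineK (Q_fin _)).
  by rewrite sumEFin -EFinM lee_fin ler_pdivrMl.
pose S : {RV P >-> R} := (\sum_(i < n) X i : {RV P >-> R}).
have SE x : S x = \sum_(i < n) X i x by rewrite /S mfun_sum.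
have mgf : ('M_P S l <= (expR (n%:R * (A * sigma ^+ 2 + D * B `^ q)))%:E)%E.
  rewrite /mmt_gen_fun expectation.unlock.
  have -> : (\int[P]_x ((expR \o l \o* S) x)%:E =
             \int[P]_x (\prod_(i < n) expR (l * X i x))%:E)%E.
    by apply: eq_integral => x _; rewrite /= SE mulrC mulr_sumr expR_sum.
  rewrite (independent_integral_prod _ _ _ _ _ X (fun=> fun r => expR (l * r)))//; last first.
    move=> i; apply: measurableT_comp; first exact: measurable_expR.
    exact: measurable_funM.
  rewrite lee_fin.
  apply: (@le_trans _ _ (\prod_(i < n) expR (A * V i + D * Q i))).
    apply: ler_prod => i _; rewrite M_le andbT; apply: fine_ge0.
    by apply: integral_ge0 => x _; rewrite lee_fin expR_ge0.
  (* [A] and [D] are common to all indices and nonnegative, so bounds on the averaged moments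
     suffice. *)
  rewrite -expR_sum ler_expR big_split/= -!mulr_sumr.
  rewrite [leRHS](_ : _ = A * (n%:R * sigma ^+ 2) + D * (n%:R * B `^ q)); last by ring.
  by apply: lerD; apply: ler_wpM2l.
rewrite [X in P X](_ : _ = [set x | S x >= n%:R * tau]); last first.
  by apply/seteqP; split => x /=; rewrite SE ler_pdivlMl.
apply: (le_trans (chernoff S (n%:R * tau) l0)).
apply: (le_trans (lee_wpmul2r _ mgf)); first by rewrite lee_fin expR_ge0.
rewrite -EFinM lee_fin -expRD.
(* Writing 1 / z as exp(-ln z) reduces the goal to a comparison of exponents, which is [n] times
   [key]. *)
rewrite -[leRHS]lnK ?posrE ?invr_gt0 ?(lt_trans ltr01)// lnV ?posrE ?(lt_trans ltr01)//.
rewrite ler_expR.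
have -> : ln z = n%:R * v by rewrite /v; field; rewrite gt_eqF.
by nra.
Qed.
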